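(* Let $G_S$ be a self-loop graph of order $N$ with $|S|\ge1$, let $\widetilde G$ be its Açıkmeşe lift, and let $T$ be the involution matrix. Let $q>0$ and $c\in\mathbb{R}$. Then $$\mathcal{M}_q(\mathcal{L}(G_S),c)=\tfrac12\mathrm{Tr}\big(\Phi_q(\mathcal{L}(\widetilde G),c)(I-T)\big),\qquad \mathcal{M}_q(M_{sym},c)=\tfrac12\mathrm{Tr}\big(\Phi_q(\mathcal{L}(\widetilde G),c)(I+T)\big).$$ Consequently, $$\mathcal{M}_q(M_{sym},c)-\mathcal{M}_q(\mathcal{L}(G_S),c)=\mathrm{Tr}\big(\Phi_q(\mathcal{L}(\widetilde G),c)\,T\big).$$
   Context: Let $G$ be a finite undirected simple graph with vertex set $V=\{1,\dots,N\}$ (possibly disconnected), and $S\subseteq V$. The self-loop graph $G_S$ is obtained from $G$ by attaching one loop at every vertex of $S$; $\sigma=|S|$. The loop vector $s\in\mathbb{R}^N$ is the indicator vector of $S$. $\mathcal{L}(G)=D(G)-A(G)$ is the ordinary Laplacian and $\mathcal{L}(G_S):=\mathcal{L}(G)+\mathrm{diag}(s)$. For $\sigma\ge1$, the Açıkmeşe lift $\widetilde G=(\widetilde V,\widetilde E)$ of $G_S$ is the simple graph on $\widetilde V=\{1,\dots,2N+1\}$ such that: for each edge $\{i,j\}$ of $G$, both $\{i,j\}$ and $\{i+N+1,j+N+1\}$ are edges of $\widetilde G$; for each $i\in S$, both $\{i,N+1\}$ and $\{N+1,i+N+1\}$ are edges; there are no other edges. $\mathcal{L}(\widetilde G)$ is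 the ordinary Laplacian of $\widetilde G$. The involution matrix $T$ is the $(2N+1)\times(2N+1)$ permutation matrix of the map swapping $i\leftrightarrow i+N+1$ ($1\le i\le N$) and fixing $N+1$; it is the image of the nontrivial element $g$ under the resulting representation of $\mathbb{Z}_2=\{1,g\}$ on $\mathbb{R}^{\widetilde V}$. $M_{sym}=\begin{pmatrix}2\sigma&-\sqrt2\,s^\top\\ -\sqrt2\,s&\mathcal{L}(G_S)\end{pmatrix}\in\mathbb{R}^{(N+1)\times(N+1)}$. For a real symmetric matrix $B$ of order $r$ with eigenvalues $\lambda_1(B),\dots,\lambda_r(B)$ (with multiplicity), $\mathcal{M}_q(B,c)=\sum_{i=1}^r|\lambda_i(B)-c|^q$, and $\Phi_q(B,c)=|B-cI_r|^q$ is defined by spectral functional calculus (apply $x\mapsto|x-c|^q$ to $B$). *)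

(* Defs.v *)
From HB Require Import structures.
From mathcomp Require Import all_boot all_order all_algebra all_fingroup.
From mathcomp Require Import all_classical all_reals all_analysis.

Set Implicit Arguments.
Unset Strict Implicit.
Unset Printing Implicit Defensive.

Import Order.TTheory GRing.Theory Num.Theory.

Local Open Scope ring_scope.

Record sgraph (n : nat) := SGraph {
  edge :> rel 'I_n;
  edge_sym : symmetric edge;
  edge_irr : irreflexive edge }.

Section Laplacian.
Variables (R : realType) (n : nat).
Implicit Types (G : sgraph n) (S : {set 'I_n}).

Definition degree G (i : 'I_n) : nat := #|[set j | edge G i j]|.

Definition adjacency_mx G : 'M[R]_n := \matrix_(i, j) (edge G i j)%:R.

Definition degree_mx G : 'M[R]_n := diag_mx (\row_i (degree G i)%:R).

Definition laplacian G : 'M[R]_n := degree_mx G - adjacency_mx G.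

Definition loop_vec S : 'cV[R]_n := \col_i (i \in S)%:R.

(* Laplacian of the self-loop graph G_S: each loop adds 1 on the diagonal. *)
Definition loop_laplacian G S : 'M[R]_n := laplacian G + diag_mx (loop_vec S)^T.

Definition Msym G S : 'M[R]_(1 + n) :=
  block_mx (2 * #|S|%:R)%:M (- (Num.sqrt 2 *: (loop_vec S)^T))
           (- (Num.sqrt 2 *: loop_vec S)) (loop_laplacian G S).

End Laplacian.

Section Lift.
Variable N : nat.

(* The 2N+1 vertices are 'I_(N + (1 + N)).  In the 1-based numbering
   1, ..., 2N+1, [vlo i] is i, [vmid] is N+1 and [vhi i] is i+N+1. *)
Definition vlo (i : 'I_N) : 'I_(N + (1 + N)) := lshift (1 + N) i.
Definition vmid : 'I_(N + (1 + N)) := rshift N (lshift N ord0).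
Definition vhi (i : 'I_N) : 'I_(N + (1 + N)) := rshift N (rshift 1 i).

Definition lift_edge (G : sgraph N) (S : {set 'I_N}) : rel 'I_(N + (1 + N)) :=
  fun u v =>
    [exists i : 'I_N, exists j : 'I_N,
        edge G i j && ((u == vlo i) && (v == vlo j)
                    || (u == vhi i) && (v == vhi j))]
    || [exists i in S, [|| (u == vlo i) && (v == vmid),
                           (u == vmid) && (v == vlo i),
                           (u == vmid) && (v == vhi i)
                         | (u == vhi i) && (v == vmid)]].

Lemma lift_edge_sym G S : symmetric (lift_edge G S).
Proof.
suff H u v : lift_edge G S u v -> lift_edge G S v u.
  by move=> u v; apply/idP/idP; exact: H.
case/orP => [/existsP[i /existsP[j /andP[eij h]]]|/existsP[i /andP[iS h]]].
  apply/orP; left; apply/existsP; exists j; apply/existsP; exists i.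
  by rewrite edge_sym eij /= andbC [X in _ || X]andbC.
apply/orP; right; apply/existsP; exists i; rewrite iS /=.
by case/or4P: h => /andP[-> ->]; rewrite ?orbT.
Qed.

Lemma lift_edge_irr G S : irreflexive (lift_edge G S).
Proof.
move=> u; apply/negbTE/negP.
case/orP => [/existsP[i /existsP[j /andP[eij h]]]|/existsP[i /andP[iS h]]].
  suff eq_ij : i = j by rewrite eq_ij edge_irr in eij.
  case/orP: h => /andP[/eqP-> /eqP]; first exact: lshift_inj.
  by move/rshift_inj/rshift_inj.
have lm : vlo i == vmid = false by exact: eq_lrshift.
have mh : vmid == vhi i = false.
  by apply/negP => /eqP/rshift_inj/eqP; rewrite eq_lrshift.
by case/or4P: h => /andP[/eqP-> ]; rewrite ?lm ?mh // eq_sym ?lm ?mh.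
Qed.

Definition acikmese_lift (G : sgraph N) (S : {set 'I_N}) :
    sgraph (N + (1 + N)) :=
  SGraph (lift_edge_sym G S) (lift_edge_irr G S).

Definition lift_swap (u : 'I_(N + (1 + N))) : 'I_(N + (1 + N)) :=
  match fintype.split u with
  | inl i => vhi i
  | inr w => match fintype.split w with inl _ => vmid | inr i => vlo i end
  end.

Lemma lift_swap_lo i : lift_swap (vlo i) = vhi i.
Proof. by rewrite /lift_swap /vlo (fintype.unsplitK (inl i)). Qed.

Lemma lift_swap_mid : lift_swap vmid = vmid.
Proof.
by rewrite /lift_swap (fintype.unsplitK (inr _)) (fintype.unsplitK (inl _)).
Qed.

Lemma lift_swap_hi i : lift_swap (vhi i) = vlo i.
Proof. by rewrite /lift_swap !(fintype.unsplitK (inr _)). Qed.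

Lemma lift_swapK : involutive lift_swap.
Proof.
move=> u; rewrite -(fintype.splitK u); case: (fintype.split u) => [i|w] /=.
  by rewrite lift_swap_lo lift_swap_hi.
rewrite -(fintype.splitK w); case: (fintype.split w) => [k|i] /=.
  by rewrite (ord1 k) !lift_swap_mid.
by rewrite lift_swap_hi lift_swap_lo.
Qed.

Definition involution_mx (R : realType) : 'M[R]_(N + (1 + N)) :=
  perm_mx (perm (can_inj lift_swapK)).

End Lift.

Section SpectralCalculus.
Variable R : realType.

(* The eigenvalues with (algebraic) multiplicity, in some order.  For a real
   symmetric B the characteristic polynomial splits over R, so the default
   value [::] is not used. *)
Definition is_spectrum n (B : 'M[R]_n) (l : seq R) : Prop :=
  char_poly B = \prod_(a <- l) ('X - a%:P).

Definition spectrum n (B : 'M[R]_n) : seq R :=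
  xget [::] [set l | is_spectrum B l]%classic.

Lemma is_spectrum_perm n (B : 'M[R]_n) l1 l2 :
  is_spectrum B l1 -> is_spectrum B l2 -> perm_eq l1 l2.
Proof. by rewrite /is_spectrum => -> /prod_XsubC_eq. Qed.

(* F = f(B): there is an orthogonal diagonalization B = P^T diag(d) P for which
   F = P^T diag(f(d)) P. *)
Definition is_fun_calc n (f : R -> R) (B F : 'M[R]_n) : Prop :=
  exists (P : 'M[R]_n) (d : 'rV[R]_n),
    [/\ P *m P^T = 1%:M,
        B = P^T *m diag_mx d *m P &
        F = P^T *m diag_mx (map_mx f d) *m P].

(* The result does not depend on the diagonalization; it exists for every real
   symmetric B, so the default value 0 is not used there. *)
Lemma is_fun_calc_uniq n (f : R -> R) (B F1 F2 : 'M[R]_n) :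
  is_fun_calc f B F1 -> is_fun_calc f B F2 -> F1 = F2.
Proof.
move=> [P [d [PP -> ->]]] [Q [e [QQ E ->]]].
have PP' := mulmx1C PP; have QQ' := mulmx1C QQ.
have [W WE] : exists W, W = Q *m P^T by exists (Q *m P^T).
have EW : W *m diag_mx d = diag_mx e *m W.
  have := congr1 (fun X => Q *m X *m P^T) E.
  by rewrite WE !mulmxA QQ mul1mx -!mulmxA PP mulmx1.
have EF : W *m diag_mx (map_mx f d) = diag_mx (map_mx f e) *m W.
  apply/matrixP => i j; move/matrixP/(_ i j): EW.
  rewrite !mul_mx_diag !mul_diag_mx !mxE => h.
  have [->|W0] := eqVneq (W i j) 0; first by rewrite mul0r mulr0.
  by rewrite mulrC; congr (f _ * _); apply: (mulIf W0); rewrite mulrC.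
have -> : P^T = Q^T *m W by rewrite WE mulmxA QQ' mul1mx.
by rewrite -(mulmxA Q^T) EF WE -!mulmxA PP' mulmx1.
Qed.

Definition fun_calc n (f : R -> R) (B : 'M[R]_n) : 'M[R]_n :=
  xget 0 [set F | is_fun_calc f B F]%classic.

Definition moment n (q : R) (B : 'M[R]_n) (c : R) : R :=
  \sum_(a <- spectrum B) `|a - c| `^ q.

Definition Phi n (q : R) (B : 'M[R]_n) (c : R) : 'M[R]_n :=
  fun_calc (fun x => `|x - c| `^ q) B.

End SpectralCalculus.

(* Main.v *)
Require Import Defs.
From mathcomp Require Import all_boot all_order all_algebra perm.
From mathcomp Require Import all_classical all_reals all_analysis.
From mathcomp Require Import complex ring.

Import Order.TTheory GRing.Theory Num.Theory.
Local Open Scope ring_scope.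

(** The swap of the two copies of [G] is an automorphism of the lift, so
    R^(2N+1) is the orthogonal sum of the vectors that it negates and the
    vectors that it fixes, and the Laplacian of the lift preserves both.  An
    antisymmetric vector vanishes at the middle vertex and is determined by its
    values on the lower copy; in the orthonormal basis (e_i - e_i')/sqrt 2 the
    Laplacian of the lift acts as that of the self-loop graph, the loop at [i]
    being what remains of the edge from [i] to the middle vertex.  The symmetric
    vectors have the orthonormal basis formed by the middle vertex and the
    (e_i + e_i')/sqrt 2, and the Laplacian acts there as [Msym]: the middle
    vertex is joined to each looped pair by two edges, which after
    normalization contribute 2/sqrt 2 = sqrt 2.

    Let Q be the orthogonal matrix whose rows are these two bases
    ([symmetry_basis]).  Conjugation by Q turns the Laplacian into
    diag(L(G_S), Msym) and T into diag(-1, 1) ([symmetry_basis_laplacian],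
    [symmetry_basis_involution]).  Functional calculus commutes with orthogonal
    conjugation and with block sums ([is_fun_calc_conj], [is_fun_calc_block]),
    and the trace of f(B) is the sum of f over the eigenvalues of B
    ([sum_spectrum]).  Hence, writing m and M for the moments of L(G_S) and
    [Msym], the trace of Phi is m + M and the trace of Phi T is M - m; the three
    formulas are linear combinations of these two.

    Functional calculus is available only for matrices that have an orthogonal
    diagonalization, so the real spectral theorem is proved first.  It needs one
    real eigenvalue, found over the complex numbers, where a real symmetric
    matrix is Hermitian; a Householder reflection then splits off the
    eigenvector and the argument continues by induction on the order. *)

(** * The real spectral theorem *)

(** Over [R[i]] the matrix is Hermitian, so its eigenvalues are real, and being
    an eigenvalue does not depend on the field that contains the scalar. *)
Lemma sym_eigenvalue (R : rcfType) n (A : 'M[R]_n.+1) :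
  A^T = A -> exists a, eigenvalue A a.
Proof.
move=> symA; set M := map_mx (real_complex R) A.
have hermM : M \is hermsymmx.
  apply: realsym_hermsym.
    apply/is_hermitianmxP; rewrite expr0 scale1r map_mx_id //.
    by rewrite /M map_trmx symA.
  by apply/mxOverP => i j; rewrite mxE complex_real.
have /orthomx_spectralP defM := hermitian_normalmx hermM.
have /mxOverP/(_ 0 0)/complex_realP[a da] := hermitian_spectral_diag_real hermM.
exists a; rewrite -(eigenvalue_map (real_complex R)) -/M.
apply/eigenvalueP; exists (row 0 (spectralmx M)).
  rewrite -row_mul {2}defM !mulmxA mulmxV ?spectral_unit // mul1mx.
  by rewrite row_mul row_diag_mx -scalemxAl -rowE da.
apply/eqP => r0; have := oner_eq0 R[i].
have /unitarymxP/matrixP/(_ 0 0) := spectral_unitarymx M.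
rewrite !mxE eqxx mulr1n => <- /eqP[]; apply: big1 => k _.
by have /rowP/(_ k) := r0; rewrite !mxE => ->; rewrite mul0r.
Qed.

Lemma mul_row_tr_gt0 (R : realDomainType) n (w : 'rV[R]_n) :
  (0 < (w *m w^T) 0 0) = (w != 0).
Proof.
have sq_ge0 i : true -> 0 <= w 0 i * w^T i 0 by rewrite mxE -expr2 sqr_ge0.
rewrite mxE lt0r psumr_neq0 // sumr_ge0 // andbT.
apply/hasP/rV0Pn => [[i _]|[i wi0]].
  by rewrite mxE -expr2 /= lt0r sqrf_eq0 => /andP[wi0 _]; exists i.
exists i; first by rewrite mem_index_enum.
by rewrite mxE -expr2 /= lt0r sqrf_eq0 sqr_ge0 wi0.
Qed.

(** The reflection that exchanges [v] with the first vector of the standard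
    basis is orthogonal, and its first row is [v]. *)
Lemma orthogonal_first_row (R : rcfType) n (v : 'rV[R]_n.+1) :
  v *m v^T = 1%:M ->
  exists2 H : 'M[R]_n.+1, H *m H^T = 1%:M & row 0 H = v.
Proof.
move=> v1; set e : 'rV[R]_n.+1 := delta_mx 0 0.
have [->|nev] := eqVneq v e.
  by exists 1%:M; rewrite ?trmx1 ?mulmx1 // rowE mulmx1.
have e1 : e *m e^T = 1%:M.
  by rewrite trmx_delta mul_delta_mx; apply/matrixP => i j; rewrite !ord1 !mxE.
(* The body of [w] is hidden, or distributivity would rewrite inside it. *)
have [w defw] : exists w, w = e - v by exists (e - v).
set t := (w *m w^T) 0 0.
have t0 : t != 0 by rewrite gt_eqF // mul_row_tr_gt0 defw subr_eq0 eq_sym.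
have ww : w *m w^T = t%:M by rewrite -mx11_scalar.
pose H := 1%:M - (2 / t) *: (w^T *m w).
have HT : H^T = H.
  by rewrite /H linearB /= linearZ /= trmx1 trmx_mul trmxK.
have ve : v *m e^T = e *m v^T.
  rewrite -[LHS]trmxK trmx_mul trmxK.
  by apply/matrixP => i j; rewrite !ord1 mxE.
(* As [e] and [v] have equal lengths, [e] makes the same angle with [w] as [- v]
   does, so that |w|^2 is twice the inner product of [e] with [w]. *)
have ew : e *m w^T = (t / 2)%:M.
  have : w *m w^T = 2 *: (e *m w^T).
    rewrite defw linearB /= !mulmxBl !mulmxBr e1 v1 ve scaler_nat mulr2n.
    by rewrite opprB.
  rewrite ww => /(congr1 ( *:%R 2^-1)); rewrite scalerA mulVf ?pnatr_eq0 //.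
  by rewrite scale1r scale_scalar_mx mulrC.
exists H.
  rewrite HT /H mulmxBl mul1mx -scalemxAl mulmxBr mulmx1 -scalemxAr.
  rewrite mulmxA -(mulmxA w^T) ww mul_mx_scalar -scalemxAl.
  move: (w^T *m w) => X; apply/matrixP => i j; rewrite !mxE.
  by field.
rewrite rowE -/e /H mulmxBr mulmx1 -scalemxAr mulmxA ew mul_scalar_mx scalerA.
by rewrite mulrA divfK // divff ?pnatr_eq0 // scale1r defw subKr.
Qed.

(** In an orthonormal basis that starts with an eigenvector the first row of the
    matrix is a multiple of the first basis vector; by symmetry so is the first
    column, and induction applies to the remaining diagonal block. *)
Lemma spectral_theorem (R : rcfType) n (A : 'M[R]_n) : A^T = A ->
  exists (P : 'M[R]_n) (d : 'rV[R]_n),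
    P *m P^T = 1%:M /\ A = P^T *m diag_mx d *m P.
Proof.
elim: n A => [A _|n IHn A symA].
  by exists 1%:M, 0; split; apply/matrixP => -[].
have [a /eigenvalueP[v vA v0]] := sym_eigenvalue _ _ A symA.
have vv_gt0 : 0 < (v *m v^T) 0 0 by rewrite mul_row_tr_gt0.
set r := Num.sqrt ((v *m v^T) 0 0).
have r0 : r != 0 by rewrite gt_eqF // sqrtr_gt0.
have [|H HH rowH] := orthogonal_first_row _ _ (r^-1 *: v).
  rewrite linearZ /= -scalemxAl -scalemxAr scalerA.
  rewrite [v *m _]mx11_scalar scale_scalar_mx -(sqr_sqrtr (ltW vv_gt0)) -/r.
  by congr _%:M; field.
have rowHA : row 0 H *m A = a *: row 0 H.
  by rewrite rowH -scalemxAl vA !scalerA mulrC.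
have [B [symB defA row0B]] : exists B : 'M[R]_(1 + n),
    [/\ B^T = B, A = H^T *m B *m H & row 0 B = a *: delta_mx 0 0].
  exists (H *m A *m H^T); split.
  - by rewrite !trmx_mul trmxK symA mulmxA.
  - by rewrite !mulmxA (mulmx1C HH) mul1mx -mulmxA (mulmx1C HH) mulmx1.
  - by rewrite !row_mul rowHA -scalemxAl -row_mul HH rowE mulmx1.
have ulB : ulsubmx B = a%:M.
  apply/matrixP => i j; rewrite !ord1 !mxE.
  have /rowP/(_ 0) := row0B; rewrite !mxE eqxx mulr1 => <-.
  by congr (B _ _); apply: val_inj.
have urB : ursubmx B = 0.
  apply/matrixP => i j; rewrite !ord1 !mxE.
  have /rowP/(_ (rshift 1 j)) := row0B; rewrite !mxE eqxx /= mulr0 => <-.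
  by congr (B _ _); apply: val_inj.
have dlB : dlsubmx B = 0 by rewrite -[LHS]trmxK trmx_dlsub symB urB trmx0.
have [|P [d [PP defdr]]] := IHn (drsubmx B).
  by rewrite trmx_drsub symB.
(* The blocks are assembled at the literal size [1 + n], which the block
   operations recognize; [n.+1] is only convertible to it. *)
pose P' : 'M[R]_(1 + n) := block_mx 1%:M 0 0 P.
have P'P' : P' *m P'^T = 1%:M.
  rewrite /P' tr_block_mx !trmx0 trmx1 mulmx_block.
  by rewrite !(mulmx0, mul0mx, addr0, add0r) mulmx1 PP -scalar_mx_block.
have defB : B = P'^T *m diag_mx (row_mx a%:M d) *m P'.
  rewrite -[LHS]submxK ulB urB dlB defdr /P' diag_mx_row.
  rewrite tr_block_mx !trmx0 trmx1 !mulmx_block.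
  rewrite !(mulmx0, mul0mx, addr0, add0r) mulmx1 mul1mx; congr block_mx.
  by apply/matrixP => i j; rewrite !ord1 !mxE.
exists (P' *m H), (row_mx a%:M d); split.
  by rewrite trmx_mul mulmxA -(mulmxA P') HH mulmx1.
by rewrite defA defB trmx_mul !mulmxA.
Qed.

(** * Functional calculus and sums over the spectrum *)

Section FunCalc.
Variables (R : realType) (f : R -> R).

Lemma is_fun_calc_conj n (Q B F : 'M[R]_n) : Q *m Q^T = 1%:M ->
  is_fun_calc f B F -> is_fun_calc f (Q^T *m B *m Q) (Q^T *m F *m Q).
Proof.
move=> QQ [P [d [PP -> ->]]]; exists (P *m Q), d.
by split; rewrite trmx_mul !mulmxA // -(mulmxA P) QQ mulmx1.
Qed.

Lemma is_fun_calc_block n1 n2 (B1 F1 : 'M[R]_n1) (B2 F2 : 'M[R]_n2) :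
  is_fun_calc f B1 F1 -> is_fun_calc f B2 F2 ->
  is_fun_calc f (block_mx B1 0 0 B2) (block_mx F1 0 0 F2).
Proof.
move=> [P1 [d1 [PP1 -> ->]]] [P2 [d2 [PP2 -> ->]]].
exists (block_mx P1 0 0 P2), (row_mx d1 d2).
by split; rewrite ?map_row_mx ?diag_mx_row tr_block_mx !trmx0 !mulmx_block
   !(mulmx0, mul0mx, addr0, add0r) // PP1 PP2 -scalar_mx_block.
Qed.

Lemma fun_calcE n (B F : 'M[R]_n) : is_fun_calc f B F -> fun_calc f B = F.
Proof.
move=> BF; apply: is_fun_calc_uniq (BF).
exact: (@xgetI _ 0 [set F' | is_fun_calc f B F']%classic F).
Qed.

(** The spectral theorem provides the orthogonal diagonalization without which
    [fun_calc f B] would be the default value. *)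
Lemma is_fun_calc_sym n (B : 'M[R]_n) : B^T = B ->
  is_fun_calc f B (fun_calc f B).
Proof.
move=> /spectral_theorem[P [d [PP defB]]].
suff BF : is_fun_calc f B (P^T *m diag_mx (map_mx f d) *m P).
  by rewrite (fun_calcE _ _ _ BF).
by exists P, d.
Qed.

Lemma char_poly_conj n (P D : 'M[R]_n) : P *m P^T = 1%:M ->
  char_poly (P^T *m D *m P) = char_poly D.
Proof.
move=> PP; have PPp : map_mx polyC P^T *m map_mx polyC P = 1%:M.
  by rewrite -map_mxM (mulmx1C PP) map_mx1.
rewrite /char_poly /char_poly_mx !map_mxM.
have -> : 'X%:M - map_mx polyC P^T *m map_mx polyC D *m map_mx polyC P =
   map_mx polyC P^T *m ('X%:M - map_mx polyC D) *m map_mx polyC P.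
  by rewrite mulmxBr mulmxBl scalar_mxC -[X in _ = X - _]mulmxA PPp mulmx1.
rewrite !det_mulmx mulrAC -det_mulmx.
by rewrite PPp det1 mul1r.
Qed.

(** The chosen spectrum is a permutation of the diagonal of any orthogonal
    diagonalization, because both give the roots of the characteristic
    polynomial. *)
Lemma sum_spectrum n (B : 'M[R]_n) : B^T = B ->
  \sum_(a <- spectrum B) f a = \tr (fun_calc f B).
Proof.
move=> /spectral_theorem[P [d [PP defB]]].
have specB : is_spectrum B [seq d 0 i | i <- enum 'I_n].
  rewrite /is_spectrum defB char_poly_conj //.
  rewrite char_poly_trig ?diag_mx_is_trig //.
  rewrite big_map big_enum; apply: eq_bigr => i _.
  by rewrite mxE eqxx.
have /is_spectrum_perm/(_ specB) permB : is_spectrum B (spectrum B).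
  exact: (@xgetI _ [::] [set l | is_spectrum B l]%classic _ specB).
rewrite (perm_big _ permB) big_map big_enum /=.
rewrite (@fun_calcE _ _ (P^T *m diag_mx (map_mx f d) *m P)); last first.
  by exists P, d.
rewrite mxtrace_mulC mulmxA PP mul1mx mxtrace_diag.
by apply: eq_bigr => i _; rewrite mxE.
Qed.

End FunCalc.

(** * The lift in block form *)

Section LiftEdges.
Variables (N : nat) (G : sgraph N) (S : {set 'I_N}).
Implicit Types i j : 'I_N.

Lemma vlo_eq i j : (vlo i == vlo j) = (i == j).
Proof. by rewrite (inj_eq (@lshift_inj _ _)). Qed.

Lemma vhi_eq i j : (vhi i == vhi j) = (i == j).
Proof. by rewrite (inj_eq (@rshift_inj _ _)) (inj_eq (@rshift_inj _ _)). Qed.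

Lemma vlo_mid i : (vlo i == vmid N) = false.
Proof. exact: eq_lrshift. Qed.

Lemma vlo_hi i j : (vlo i == vhi j) = false.
Proof. exact: eq_lrshift. Qed.

Lemma vhi_mid i : (vhi i == vmid N) = false.
Proof. by rewrite (inj_eq (@rshift_inj _ _)) eq_rlshift. Qed.

Lemma vhi_lo i j : (vhi i == vlo j) = false.
Proof. exact: eq_rlshift. Qed.

Lemma vmid_lo i : (vmid N == vlo i) = false.
Proof. exact: eq_rlshift. Qed.

Lemma vmid_hi i : (vmid N == vhi i) = false.
Proof. by rewrite eq_sym vhi_mid. Qed.

Definition v_eqE := (vlo_eq, vhi_eq, vlo_mid, vlo_hi, vhi_mid, eqxx,
  vmid_lo, vmid_hi, vhi_lo).

Lemma lift_edge_loE i j : lift_edge G S (vlo i) (vlo j) = edge G i j.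
Proof.
rewrite /lift_edge; apply/orP/idP => [[]|eij].
- case/existsP => k /existsP[l]; rewrite !v_eqE orbF.
  by case/and3P => ekl /eqP-> /eqP->.
- by case/existsP => k; rewrite !v_eqE !(andbF, andFb).
left; apply/existsP; exists i; apply/existsP; exists j.
by rewrite eij !eqxx.
Qed.

Lemma lift_edge_hiE i j : lift_edge G S (vhi i) (vhi j) = edge G i j.
Proof.
rewrite /lift_edge; apply/orP/idP => [[]|eij].
- case/existsP => k /existsP[l]; rewrite !v_eqE /=.
  by case/and3P => ekl /eqP-> /eqP->.
- by case/existsP => k; rewrite !v_eqE !(andbF, andFb).
left; apply/existsP; exists i; apply/existsP; exists j.
by rewrite eij !eqxx orbT.
Qed.

Lemma lift_edge_lo_hi i j : lift_edge G S (vlo i) (vhi j) = false.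
Proof.
apply/negbTE/negP => /orP[/existsP[k /existsP[l]]|/existsP[k]];
  by rewrite !v_eqE ?andbF.
Qed.

Lemma lift_edge_lo_mid i : lift_edge G S (vlo i) (vmid N) = (i \in S).
Proof.
rewrite /lift_edge; apply/orP/idP => [[]|iS].
- by case/existsP => k /existsP[l]; rewrite !v_eqE !andbF.
- case/existsP => k; rewrite !v_eqE /= ?(andbF, orbF, andbT).
  by case/andP => ? /eqP->.
by right; apply/existsP; exists i; rewrite iS !v_eqE.
Qed.

Lemma lift_edge_hi_lo i j : lift_edge G S (vhi i) (vlo j) = false.
Proof. by rewrite lift_edge_sym lift_edge_lo_hi. Qed.

Lemma lift_edge_mid_lo i : lift_edge G S (vmid N) (vlo i) = (i \in S).
Proof. by rewrite lift_edge_sym lift_edge_lo_mid. Qed.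

Lemma lift_edge_hi_mid i : lift_edge G S (vhi i) (vmid N) = (i \in S).
Proof.
rewrite /lift_edge; apply/orP/idP => [[]|iS].
- by case/existsP => k /existsP[l]; rewrite !v_eqE !andbF.
- case/existsP => k; rewrite !v_eqE /= ?(andbF, orbF, andbT).
  by case/andP => ? /eqP->.
by right; apply/existsP; exists i; rewrite iS !v_eqE !orbT.
Qed.

Lemma lift_edge_mid_hi i : lift_edge G S (vmid N) (vhi i) = (i \in S).
Proof. by rewrite lift_edge_sym lift_edge_hi_mid. Qed.

Lemma lift_edge_mid_mid : lift_edge G S (vmid N) (vmid N) = false.
Proof. exact: lift_edge_irr. Qed.

Definition lift_edgeE := (lift_edge_loE, lift_edge_hiE, lift_edge_lo_hi,
  lift_edge_lo_mid, lift_edge_hi_mid, lift_edge_mid_mid,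
  lift_edge_hi_lo, lift_edge_mid_lo, lift_edge_mid_hi).

End LiftEdges.

Variant lift_vertex_spec N : 'I_(N + (1 + N)) -> Type :=
  | LowVertex i : lift_vertex_spec N (vlo i)
  | MidVertex : lift_vertex_spec N (vmid N)
  | HighVertex i : lift_vertex_spec N (vhi i).

Lemma lift_vertexP N (u : 'I_(N + (1 + N))) : lift_vertex_spec N u.
Proof.
rewrite -(fintype.splitK u); case: (fintype.split u) => [i|w] /=.
  exact: LowVertex.
rewrite -(fintype.splitK w); case: (fintype.split w) => [k|i] /=.
  by rewrite ord1; exact: MidVertex.
exact: HighVertex.
Qed.

Section LiftMatrices.
Variables (R : realType) (N : nat) (G : sgraph N) (S : {set 'I_N}).

(** The degree is written as a row sum of adjacencies, which splits along the
    three kinds of vertices of the lift. *)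
Lemma laplacianE n (H : sgraph n) i j :
  laplacian R H i j = (\sum_k (edge H i k)%:R) *+ (i == j) - (edge H i j)%:R.
Proof.
rewrite !mxE; congr (_ *+ _ - _); rewrite /degree -sum1dep_card natr_sum.
by rewrite big_mkcond; apply: eq_bigr => k _; case: (edge H i k).
Qed.

Lemma laplacian_sym n (H : sgraph n) : (laplacian R H)^T = laplacian R H.
Proof.
rewrite /laplacian linearB /= tr_diag_mx; congr (_ - _).
by apply/matrixP => i j; rewrite !mxE edge_sym.
Qed.

Lemma loop_laplacian_sym : (loop_laplacian R G S)^T = loop_laplacian R G S.
Proof. by rewrite /loop_laplacian linearD /= laplacian_sym tr_diag_mx. Qed.

Lemma Msym_sym : (Msym R G S)^T = Msym R G S.
Proof.
by rewrite /Msym tr_block_mx tr_scalar_mx !linearN !linearZ /= trmxK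
   loop_laplacian_sym.
Qed.

Local Notation s := (loop_vec R S).
Local Notation L := (loop_laplacian R G S).

Lemma loop_laplacianE i j : L i j =
  (\sum_k (edge G i k)%:R + (i \in S)%:R) *+ (i == j) - (edge G i j)%:R.
Proof. by rewrite mxE laplacianE !mxE mulrnDl addrAC. Qed.

(** Each vertex of either copy gets one extra neighbour, the middle vertex,
    exactly when it carries a loop; this is the diagonal term that turns the
    Laplacian of [G] into that of the self-loop graph.  The middle vertex is
    joined to both copies of [S]. *)
Lemma lift_laplacian_block : laplacian R (acikmese_lift G S) =
  block_mx L (row_mx (- s) 0)
    (col_mx (- s^T) 0) (block_mx (2 * #|S|%:R)%:M (- s^T) (- s) L).
Proof.
have sumE (F : 'I_(N + (1 + N)) -> R) :
    \sum_u F u = \sum_i F (vlo i) + (F (vmid N) + \sum_i F (vhi i)).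
  by rewrite !big_split_ord big_ord1.
have sumS : \sum_i (i \in S)%:R = #|S|%:R :> R.
  rewrite -sum1_card natr_sum [RHS]big_mkcond; apply: eq_bigr => i _.
  by case: ifP.
have deg_lo i : \sum_u (lift_edge G S (vlo i) u)%:R =
    \sum_k (edge G i k)%:R + (i \in S)%:R :> R.
  rewrite sumE lift_edgeE [X in _ + (_ + X)]big1 => [|k _]; last first.
    by rewrite lift_edgeE.
  by rewrite addr0; congr (_ + _); apply: eq_bigr => k _; rewrite lift_edgeE.
have deg_hi i : \sum_u (lift_edge G S (vhi i) u)%:R =
    \sum_k (edge G i k)%:R + (i \in S)%:R :> R.
  rewrite sumE lift_edgeE [X in X + _]big1 => [|k _]; last first.
    by rewrite lift_edgeE.
  rewrite add0r addrC; congr (_ + _).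
  by apply: eq_bigr => k _; rewrite lift_edgeE.
have deg_mid : \sum_u (lift_edge G S (vmid N) u)%:R = 2 * #|S|%:R :> R.
  rewrite sumE lift_edgeE add0r mulrDl mul1r -sumS.
  by congr (_ + _); apply: eq_bigr => k _; rewrite lift_edgeE.
apply/matrixP => u v; rewrite laplacianE /=.
case: (lift_vertexP N u) => [i||i];
  [rewrite deg_lo|rewrite deg_mid|rewrite deg_hi];
  case: (lift_vertexP N v) => [j||j]; rewrite v_eqE lift_edgeE /vlo /vhi /vmid.
all: rewrite ?(block_mxEul, block_mxEur, block_mxEdl, block_mxEdr).
all: rewrite ?(row_mxEl, row_mxEr, col_mxEu, col_mxEd).
all: rewrite ?(block_mxEul, block_mxEur, block_mxEdl, block_mxEdr).
all: rewrite ?loop_laplacianE //.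
all: rewrite !mxE ?mulr0n ?subr0 ?sub0r ?oppr0 // mulr1n.
Qed.

Lemma involution_block : involution_mx N R =
  block_mx 0 (row_mx 0 1%:M) (col_mx 0 1%:M) (block_mx 1%:M 0 0 0).
Proof.
apply/matrixP => u v; rewrite /involution_mx /perm_mx 2!mxE permE.
by case: (lift_vertexP N u) => [i||i]; case: (lift_vertexP N v) => [j||j];
  rewrite ?(lift_swap_lo, lift_swap_mid, lift_swap_hi) v_eqE;
  rewrite /vlo /vhi /vmid;
  rewrite ?(block_mxEul, block_mxEur, block_mxEdl, block_mxEdr);
  rewrite ?(row_mxEl, row_mxEr, col_mxEu, col_mxEd);
  rewrite ?(block_mxEul, block_mxEur, block_mxEdl, block_mxEdr) !mxE.
Qed.

(** * The symmetric and antisymmetric vectors *)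

(** The rows are, in this order, the antisymmetric vectors (e_i - e_i')/sqrt 2,
    the middle vertex, and the symmetric vectors (e_i + e_i')/sqrt 2. *)
Definition symmetry_basis : 'M[R]_(N + (1 + N)) :=
  let h := (Num.sqrt 2)^-1 in
  block_mx h%:M (row_mx 0 (- h%:M)) (col_mx 0 h%:M) (block_mx 1%:M 0 0 h%:M).

Definition mul_blockE := (mulmx_block, mul_row_block, mul_block_col,
  mul_row_col, mul_col_row, mul_mx_row, mul_col_mx, mulmx0, mul0mx, mulmx1,
  mul1mx, mulNmx, mulmxN, addr0, add0r).

Lemma symmetry_basis_orthogonal : symmetry_basis *m symmetry_basis^T = 1%:M.
Proof.
have hh : (Num.sqrt 2)^-1 * (Num.sqrt 2)^-1 = 2^-1 :> R.
  by rewrite -invfM -expr2 sqr_sqrtr.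
rewrite /symmetry_basis; move: (_^-1) hh => h hh.
rewrite !tr_block_mx tr_row_mx tr_col_mx !trmx0 linearN /= !tr_scalar_mx.
rewrite !(mul_blockE, opprK) !add_block_mx !add_row_mx !add_col_mx.
rewrite !mul_scalar_mx !scale_scalar_mx hh.
rewrite !(addr0, add0r, subrr) -raddfD /= row_mx0 col_mx0.
have -> : 2^-1 + 2^-1 = 1 :> R by field.
by rewrite -!scalar_mx_block.
Qed.

(** An antisymmetric vector feels the middle vertex only through the degrees,
    since its contributions from the two copies cancel there; a symmetric one
    meets it with weight h + h = sqrt 2, where h = 1/sqrt 2. *)
Lemma symmetry_basis_laplacian :
  symmetry_basis *m laplacian R (acikmese_lift G S) =
  block_mx L 0 0 (Msym R G S) *m symmetry_basis.
Proof.
rewrite lift_laplacian_block /symmetry_basis /Msym.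
move: L s => A x.
have r0 : Num.sqrt 2 != 0 :> R by rewrite sqrtr_eq0 -ltNge.
have rr : Num.sqrt 2 * Num.sqrt 2 = 2 :> R by rewrite -expr2 sqr_sqrtr.
move: (Num.sqrt 2) r0 rr => r r0 rr.
have h1 : r^-1 * r = 1 by rewrite mulVf.
have hh : r^-1 + r^-1 = r by rewrite -mulr2n -mulr_natr -rr mulKf.
move: (r^-1) h1 hh => h h1 hh.
rewrite !(mul_blockE, opprK) !add_block_mx !add_row_mx !add_col_mx.
rewrite !mul_scalar_mx !mul_mx_scalar !scalerA h1 scale1r row_mx0.
by rewrite !(addr0, add0r) addNr -opprD -scalerDl hh.
Qed.

Lemma symmetry_basis_involution :
  symmetry_basis *m involution_mx N R =
  block_mx (- 1%:M) 0 0 1%:M *m symmetry_basis.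
Proof.
rewrite involution_block /symmetry_basis; move: (_^-1) => h.
by rewrite !(mul_blockE, opprK) !row_mx0 !add_block_mx !(addr0, add0r).
Qed.

(** Functional calculus does not depend on the chosen diagonalization, so it may
    be computed from diagonalizations of the two blocks. *)
Lemma fun_calc_lift_laplacian (f : R -> R) :
  fun_calc f (laplacian R (acikmese_lift G S)) =
  symmetry_basis^T *m
    block_mx (fun_calc f L) 0 0 (fun_calc f (Msym R G S)) *m symmetry_basis.
Proof.
have QQ := symmetry_basis_orthogonal.
have -> : laplacian R (acikmese_lift G S) =
    symmetry_basis^T *m block_mx L 0 0 (Msym R G S) *m symmetry_basis.
  by rewrite -mulmxA -symmetry_basis_laplacian mulmxA (mulmx1C QQ) mul1mx.
apply/fun_calcE/is_fun_calc_conj => //.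
by apply: is_fun_calc_block; apply: is_fun_calc_sym;
  [exact: loop_laplacian_sym | exact: Msym_sym].
Qed.

Lemma trace_fun_calc_lift (f : R -> R) :
  \tr (fun_calc f (laplacian R (acikmese_lift G S))) =
  \tr (fun_calc f L) + \tr (fun_calc f (Msym R G S)).
Proof.
rewrite fun_calc_lift_laplacian mxtrace_mulC mulmxA.
by rewrite symmetry_basis_orthogonal mul1mx mxtrace_block.
Qed.

(** In the symmetry basis the involution is diag(-1, 1), which is where the
    minus sign comes from. *)
Lemma trace_fun_calc_lift_involution (f : R -> R) :
  \tr (fun_calc f (laplacian R (acikmese_lift G S)) *m involution_mx N R) =
  \tr (fun_calc f (Msym R G S)) - \tr (fun_calc f L).
Proof.
rewrite fun_calc_lift_laplacian -!mulmxA symmetry_basis_involution.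
rewrite mxtrace_mulC -!mulmxA symmetry_basis_orthogonal mulmx1.
by rewrite !(mul_blockE, opprK) mxtrace_block linearN addrC.
Qed.

End LiftMatrices.

(** * The moment formulas *)

Theorem theorem4p7 (R : realType) (N : nat) (G : sgraph N) (S : {set 'I_N})
    (hS : (1 <= #|S|)%N) (q : R) (hq : 0 < q) (c : R) :
  let L := loop_laplacian R G S in
  let M := Msym R G S in
  let Lt := laplacian R (acikmese_lift G S) in
  let T := involution_mx N R in
  [/\ moment q L c = 2^-1 * \tr (Phi q Lt c *m (1%:M - T)),
      moment q M c = 2^-1 * \tr (Phi q Lt c *m (1%:M + T)) &
      moment q M c - moment q L c = \tr (Phi q Lt c *m T)].
Proof.
move=> L M Lt T.
have -> : moment q L c = \tr (Phi q L c).
  exact: (sum_spectrum _ (fun x => `|x - c| `^ q) _ _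
    (loop_laplacian_sym _ _ _ _)).
have -> : moment q M c = \tr (Phi q M c).
  exact: (sum_spectrum _ (fun x => `|x - c| `^ q) _ _ (Msym_sym _ _ _ _)).
rewrite mulmxBr mulmxDr mulmx1 linearB linearD /= /T /Lt /Phi.
rewrite trace_fun_calc_lift trace_fun_calc_lift_involution.
by split=> //; field.
Qed.
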